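(* Let $\varphi:G_1\to G_2$ be a group homomorphism whose kernel is finite. If $H_2\subseteq\varphi(G_1)$ is an almost normal subgroup of $G_2$ and the Hecke pair $(G_2,H_2)$ has (RD), then the Hecke pair $(G_1,\varphi^{-1}(H_2))$ has (RD).
   Context: All groups are discrete. A subgroup $H\leq G$ is almost normal if every double coset $HgH$ ($g\in G$) is a union of finitely many left cosets of $H$; then $(G,H)$ is called a Hecke pair. A length function on $G$ is a map $L:G\to[0,\infty)$ with $L(1)=0$, $L(g^{-1})=L(g)$ and $L(gh)\leq L(g)+L(h)$ for all $g,h\in G$; put $N_L=\{g\in G: L(g)=0\}$. A length function on a Hecke pair $(G,H)$ is a length function $L$ on $G$ with $H\subseteq N_L$ (so $L$ is constant on double cosets of $H$). $\mathcal{H}(G,H)$ is the space of finitely supported complex functions on the set of double cosets $G//H$, regarded as $H$-bi-invariant functions on $G$; elements of $\ell^2(H\backslash G)$ are regarded as left $H$-invariant functions on $G$. The regular representation $\lambda:\mathcal{H}(G,H)\to\mathcal{B}(\ell^2(H\backslash G))$ is $\lambda(f)(\xi)(g)=\sum_{h\in H\backslash G} f(gh^{-1})\xi(h)$ (sum over representatives of right cosets). For $s\geq 0$, $\|f\|_{s,L}=\big(\sum_{g\in H\backslash G}|f(g)|^2(1+L(g))^{2s}\big)^{1/2}$. The Hecke pair $(G,H)$ has property (RD) with respect to a length function $L$ on $(G,H)$ if there are $C,s>0$ with $\|\lambda(f)\|\leq C\|f\|_{s,L}$ for all $f\in\mathcal{H}(G,H)$. ''The Hecke pair $(G,H)$ has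 (RD)'' means that $H$ is almost normal in $G$ and $(G,H)$ has (RD) with respect to some length function on $(G,H)$. *)

(* Defs.v *)
From mathcomp Require Import all_boot all_order all_algebra.
From mathcomp Require Import complex.
From mathcomp Require Import all_classical all_reals all_analysis.

Set Implicit Arguments.
Unset Strict Implicit.
Unset Printing Implicit Defensive.

Import Order.TTheory GRing.Theory Num.Theory.
Import ComplexField.Normc.

Local Open Scope classical_set_scope.
Local Open Scope ring_scope.
Local Open Scope ereal_scope.

Section HeckePair.
Variable G : groupType.
Implicit Types (H : set G) (g x : G).

Definition left_coset g H : set G := [set (g * h)%g | h in H].

Definition right_coset H g : set G := [set (h * g)%g | h in H].

Definition double_coset H g : set G :=
  [set (h * g * k)%g | h in H & k in H].

Definition right_cosets H : set (set G) := range (right_coset H).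

Definition is_subgroup H : Prop := group_closed [in H].

Definition almost_normal H : Prop :=
  is_subgroup H /\
  forall g, exists2 S : set G, finite_set S &
    double_coset H g = \bigcup_(x in S) left_coset x H.

(* A representative of a (nonempty) coset [A]; all the functions evaluated at
   [coset_repr A] below are constant on the right cosets of [H]. *)
Definition coset_repr (A : set G) : G := xget 1%g A.

End HeckePair.

Section RapidDecay.
Variables (R : realType) (G : groupType).
Implicit Types (H : set G) (L : G -> R) (f xi : G -> R[i]).

Definition length_function L : Prop :=
  [/\ forall g, (0 <= L g)%R,
      L 1%g = 0%R,
      forall g, L (g^-1)%g = L g &
      forall g h, (L (g * h)%g <= L g + L h)%R].

Definition null_set L : set G := [set g | L g = 0%R].

Definition length_function_on H L : Prop :=
  length_function L /\ H `<=` null_set L.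

(* The elements of [H(G,H)], as [H]-bi-invariant functions on [G]. *)
Definition hecke_algebra H : set (G -> R[i]) :=
  [set f | (forall h k g, H h -> H k -> f (h * g * k)%g = f g) /\
           finite_set [set double_coset H g | g in [set g | f g != 0%R]]].

(* The norm on [H(G,H)], with values in the extended reals. *)
Definition sobolev_norm H (s : R) L f : \bar R :=
  sqrte (\esum_(A in right_cosets H)
     (normc (f (coset_repr A)) ^+ 2 *
      (1 + L (coset_repr A)) `^ (2 * s))%:E).

(* [+oo] for a left [H]-invariant function that is not square-summable. *)
Definition l2_norm H xi : \bar R :=
  sqrte (\esum_(A in right_cosets H)
     (normc (xi (coset_repr A)) ^+ 2)%:E).

Definition l2 H : set (G -> R[i]) :=
  [set xi | (forall h g, H h -> xi (h * g)%g = xi g) /\ l2_norm H xi < +oo].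

(* The sum is the finitely supported one of [fsbigop]: if [H] is almost normal
   and [f] is in [hecke_algebra H], then for each [g] only finitely many right
   cosets contribute. *)
Definition regular_rep H f xi : G -> R[i] := fun g =>
  (\sum_(A \in right_cosets H)
     f (g * (coset_repr A)^-1)%g * xi (coset_repr A))%R.

(* The operator norm of a map on [l2 H]; [+oo] if the map is unbounded. *)
Definition op_norm H (T : (G -> R[i]) -> (G -> R[i])) : \bar R :=
  ereal_sup [set l2_norm H (T xi) |
    xi in [set xi | l2 H xi /\ l2_norm H xi <= 1]].

Definition property_RD H L : Prop :=
  exists C s : R, [/\ (0 < C)%R, (0 < s)%R &
    forall f, hecke_algebra H f ->
      op_norm H (regular_rep H f) <= C%:E * sobolev_norm H s L f].

Definition hecke_pair_RD H : Prop :=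
  almost_normal H /\ exists2 L, length_function_on H L & property_RD H L.

End RapidDecay.

(* Main.v *)
(** Since [H2] is contained in the image of [phi], the preimage
    [H1 = phi^-1(H2)] contains the kernel and maps onto [H2]; hence [phi]
    identifies [H1 \ G1] with the set of those right cosets of [H2] that lie in
    the image of [phi].  Extending functions by zero outside this image embeds
    [l^2(H1 \ G1)] isometrically in [l^2(H2 \ G2)] and [H(G1, H1)] in
    [H(G2, H2)], preserves the Sobolev norms when [G1] carries the length
    [L \o phi], and intertwines the regular representations on the image of
    [phi], so the RD inequality of [(G2, H2)] restricts to [(G1, H1)]. *)
Require Import Defs.
From mathcomp Require Import all_boot all_order all_algebra.
From mathcomp Require Import complex.
From mathcomp Require Import all_classical all_reals all_analysis.

Import Order.TTheory GRing.Theory Num.Theory ComplexField.Normc.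

Local Open Scope classical_set_scope.

(** * Multiplicative maps between groups *)

Section MultiplicativeGroups.
Context {G1 G2 : groupType} (phi : {multiplicative G1 -> G2}).

Lemma multiplicative1 : phi 1%g = 1%g.
Proof. by apply: (mulgI (phi 1%g)); rewrite -gmulfM !mulg1. Qed.

Lemma multiplicativeV (x : G1) : phi x^-1%g = (phi x)^-1%g.
Proof. by apply: (mulgI (phi x)); rewrite -gmulfM !mulgV multiplicative1. Qed.

End MultiplicativeGroups.

(** * Subgroups, right cosets and their chosen representatives *)

Section Subgroup.
Context {G : groupType} {H : set G} (sH : is_subgroup H).

Lemma subgroup1 : H 1%g.
Proof. by case: sH => /set_mem. Qed.

Lemma subgroupV {x : G} : H x -> H x^-1%g.
Proof. by move=> /mem_set Hx; apply/set_mem/(group_closedV sH). Qed.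

Lemma subgroupM {x y : G} : H x -> H y -> H (x * y)%g.
Proof.
by move=> /mem_set Hx /mem_set Hy; apply/set_mem/(group_closedM sH).
Qed.

Lemma right_coset_id (g : G) : right_coset H g g.
Proof. by exists 1%g; [exact: subgroup1|rewrite mul1g]. Qed.

Lemma right_coset_eq (a b : G) : right_coset H b a ->
  right_coset H a = right_coset H b.
Proof.
move=> [h Hh <-]; apply/seteqP; split=> _ [k Hk <-].
  by exists (k * h)%g; [exact: subgroupM|rewrite mulgA].
exists (k * h^-1)%g; first by apply: subgroupM => //; exact: subgroupV.
by rewrite mulgA mulgVK.
Qed.

Lemma coset_repr_mem (A : set G) : right_cosets H A -> A (coset_repr A).
Proof. by move=> [g _ <-]; apply: xgetPex; exists g; exact: right_coset_id. Qed.

Lemma right_cosets_eq (A : set G) (a : G) :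
  right_cosets H A -> A a -> A = right_coset H a.
Proof. by move=> [g _ <-] /right_coset_eq ->. Qed.

End Subgroup.

(** * Cosets of [H2] against cosets of its preimage [H1] *)

Section Preimage.
Context {G1 G2 : groupType} {phi : {multiplicative G1 -> G2}} {H2 : set G2}.
Hypotheses (sH2 : is_subgroup H2) (H2phi : H2 `<=` range phi).
Let H1 : set G1 := phi @^-1` H2.

Lemma is_subgroup_preimage : is_subgroup H1.
Proof.
split; first by apply/mem_set; rewrite /H1/= multiplicative1; exact: subgroup1.
move=> x y /set_mem Hx /set_mem Hy; apply/mem_set.
rewrite /H1/= gmulfM multiplicativeV.
by apply: subgroupM => //; exact: subgroupV.
Qed.

Lemma double_coset_preimage (g : G1) :
  double_coset H1 g = phi @^-1` double_coset H2 (phi g).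
Proof.
apply/seteqP; split=> [_ [h Hh [k Hk <-]]|y [h Hh [k Hk]]].
  by exists (phi h) => //; exists (phi k) => //; rewrite !gmulfM.
have [h' _ h'E] := H2phi _ Hh; have [k' _ k'E] := H2phi _ Hk.
rewrite -h'E -k'E -!gmulfM => yE.
exists h'; first by rewrite /H1/= h'E.
(* The lift [k'] need not work as right factor: [y] and [h' * g * k'] have the same image but may
   differ by a kernel element. The factor chosen here absorbs it and still maps to [k]. *)
exists ((h' * g)^-1 * y)%g; last by rewrite mulVKg.
by rewrite /H1/= gmulfM multiplicativeV -yE -multiplicativeV -gmulfM mulKg k'E.
Qed.

Lemma double_coset_image (g : G1) :
  phi @` double_coset H1 g = double_coset H2 (phi g).
Proof.
apply/seteqP; split=> [_ [y + <-]|y yD]; first by rewrite double_coset_preimage.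
have [x _ xE] : range phi y.
  case: yD => [h /H2phi[h' _ <-] [k /H2phi[k' _ <-] <-]].
  by rewrite -!gmulfM; exists (h' * g * k')%g.
by exists x => //; rewrite double_coset_preimage /= xE.
Qed.

Lemma right_coset_image (g : G1) :
  phi @` right_coset H1 g = right_coset H2 (phi g).
Proof.
apply/seteqP; split=> [_ [_ [h Hh <-] <-]|_ [h Hh <-]].
  by exists (phi h) => //; rewrite gmulfM.
have [h' _ h'E] := H2phi _ Hh.
exists (h' * g)%g; last by rewrite gmulfM h'E.
by exists h' => //; rewrite /H1/= h'E.
Qed.

Lemma right_coset_preimage (g : G1) :
  phi @^-1` right_coset H2 (phi g) = right_coset H1 g.
Proof.
apply/seteqP; split=> [y [h Hh yE]|_ [h Hh <-]].
  exists (y * g^-1)%g; last by rewrite mulgVK.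
  by rewrite /H1/= gmulfM multiplicativeV -yE mulgK.
by exists (phi h) => //; rewrite gmulfM.
Qed.

(** The finite decomposition of the double coset of [phi g] is pulled back by choosing one preimage
    of each representative; since [H1] contains the kernel, the left coset obtained does not depend
    on the choice. *)
Lemma almost_normal_preimage : almost_normal H2 -> almost_normal H1.
Proof.
move=> [_ anH2]; split; first exact: is_subgroup_preimage.
move=> g; have [S finS SE] := anH2 (phi g).
pose pre (y : G2) : G1 := xget 1%g (phi @^-1` [set y]).
have preK y : range phi y -> phi (pre y) = y.
  by move=> [x _ xy]; apply: (@xgetPex _ 1%g (phi @^-1` [set y])); exists x.
(* The default value of [pre] never occurs on [S]: each [y] in [S] lies in its own left coset, hence
   in the double coset of [phi g], which is an image under [phi]. *)
have Sphi y : S y -> range phi y.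
  move=> Sy.
  have : double_coset H2 (phi g) y.
    by rewrite SE; exists y => //; exists 1%g; [exact: subgroup1|rewrite mulg1].
  by rewrite -double_coset_image => -[x _ <-]; exists x.
exists (pre @` S); first exact: finite_image.
rewrite double_coset_preimage SE; apply/seteqP; split.
  move=> x [y Sy [h Hh yhE]]; exists (pre y); first by exists y.
  exists ((pre y)^-1 * x)%g; last by rewrite mulVKg.
  by rewrite /H1/= gmulfM multiplicativeV (preK _ (Sphi _ Sy)) -yhE mulKg.
move=> _ [_ [y Sy <-] [h Hh <-]]; exists y => //; exists (phi h) => //.
by rewrite gmulfM (preK _ (Sphi _ Sy)).
Qed.

(** A right coset of [H1] is recovered as the full preimage of its image, whence injectivity. A
    right coset of [H2] lies inside the image of [phi] or misses it, so testing its representative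
    suffices. *)
Lemma set_bij_right_cosets_image :
  set_bij (right_cosets H1)
    [set A | right_cosets H2 A /\ range phi (coset_repr A)] (image^~ phi).
Proof.
split.
- move=> _ [g _ <-]; rewrite /= right_coset_image.
  have cA : right_cosets H2 (right_coset H2 (phi g)) by exists (phi g).
  split=> //; have [h Hh <-] := coset_repr_mem sH2 _ cA.
  by have [h' _ <-] := H2phi _ Hh; rewrite -gmulfM; exists (h' * g)%g.
- move=> A B /set_mem[a _ <-] /set_mem[b _ <-].
  by rewrite !right_coset_image -!right_coset_preimage => ->.
- move=> A [cA [x _ xA]]; exists (right_coset H1 x); first by exists x.
  rewrite right_coset_image xA.
  by rewrite -(right_cosets_eq sH2 _ _ cA (coset_repr_mem sH2 _ cA)).
Qed.

(** [phi] need not commute with the arbitrary choice made by [coset_repr]; the discrepancy is a left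
    factor in [H2], invisible to left [H2]-invariant functions. *)
Lemma coset_repr_image (A : set G1) : right_cosets H1 A ->
  right_coset H2 (phi (coset_repr A)) (coset_repr (phi @` A)).
Proof.
move=> cA; have rA := coset_repr_mem is_subgroup_preimage _ cA.
have AE := right_cosets_eq is_subgroup_preimage _ _ cA rA.
rewrite {2}AE right_coset_image.
by apply: (coset_repr_mem sH2); exists (phi (coset_repr A)).
Qed.

Lemma eq_coset_repr_image {T : Type} (a : G2 -> T) (A : set G1) :
  (forall h g, H2 h -> a (h * g)%g = a g) -> right_cosets H1 A ->
  a (coset_repr (phi @` A)) = a (phi (coset_repr A)).
Proof. by move=> aH2 /coset_repr_image[h Hh <-]; rewrite aH2. Qed.

(** Cosets outside the image contribute zero, and the others are reindexed by the bijection
    above. *)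
Lemma esum_right_cosets_image (R : realType) (a : G2 -> \bar R) :
  (forall h g, H2 h -> a (h * g)%g = a g) ->
  (forall g, ~ range phi g -> a g = 0%E) ->
  (\esum_(A in right_cosets H2) a (coset_repr A) =
   \esum_(A in right_cosets H1) a (phi (coset_repr A)))%R.
Proof.
move=> aH2 a0.
have -> : (\esum_(A in right_cosets H1) a (phi (coset_repr A)) =
    \esum_(A in right_cosets H1) a (coset_repr (phi @` A)))%R.
  by apply: eq_esum => A cA; rewrite eq_coset_repr_image.
rewrite -(reindex_esum _ _ _ (a \o @coset_repr G2) set_bij_right_cosets_image).
rewrite (esum_mkcondr _ [set A | range phi (coset_repr A)]).
by apply: eq_esum => A cA; case: ifPn => // /negP nA; apply: a0 => rA;
  apply: nA; exact/mem_set.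
Qed.

(** Same argument as for [esum]. The nonzero terms correspond bijectively, so the two sides agree
    also when there are infinitely many of them and both sums are 0 by convention. *)
Lemma fsbig_right_cosets_image (V : nmodType) (a : G2 -> V) :
  (forall h g, H2 h -> a (h * g)%g = a g) ->
  (forall g, ~ range phi g -> a g = 0%R) ->
  (\sum_(A \in right_cosets H2) a (coset_repr A) =
   \sum_(A \in right_cosets H1) a (phi (coset_repr A)))%R.
Proof.
move=> aH2 a0.
have -> : (\sum_(A \in right_cosets H1) a (phi (coset_repr A)) =
    \sum_(A \in right_cosets H1) a (coset_repr (phi @` A)))%R.
  by apply: eq_fsbigr => A /set_mem cA; rewrite eq_coset_repr_image.
rewrite -(reindex_fsbig _ _ _ (a \o @coset_repr G2) set_bij_right_cosets_image).
apply/esym/fsbig_widen; first by move=> A [].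
by move=> A [cA nA]; apply: a0 => rA; exact: nA.
Qed.

End Preimage.

(** * Extension by zero along [phi] *)

Section ExtensionByZero.
Context {G1 G2 : groupType} {phi : {multiplicative G1 -> G2}}.

(** The value on the image is read at an arbitrary preimage, so this extends [f] only when [f] is
    constant on the fibres of [phi]. *)
Definition extend0 {V : nmodType} (f : G1 -> V) (y : G2) : V :=
  if y \in range phi then f (xget 1%g (phi @^-1` [set y])) else 0%R.

Lemma extend0_out {V : nmodType} (f : G1 -> V) (y : G2) :
  ~ range phi y -> extend0 f y = 0%R.
Proof. by rewrite /extend0; case: ifPn => // /set_mem. Qed.

Section Invariant.
Context {V : nmodType} {H2 : set G2} (f : G1 -> V).
Hypotheses (sH2 : is_subgroup H2) (H2phi : H2 `<=` range phi).
Hypothesis fH : forall h g, H2 (phi h) -> f (h * g)%g = f g.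

Lemma extend0E (x : G1) : extend0 f (phi x) = f x.
Proof.
rewrite /extend0 ifT; last by apply/mem_set; exists x.
have := @xgetPex _ 1%g (phi @^-1` [set phi x]) (ex_intro _ x erefl).
set y := xget _ _ => /= yE.
(* The chosen preimage [y] is [(y * x^-1) * x], whose left factor is in the kernel, so the
   invariance of [f] removes it. *)
rewrite -[y](mulgVK x) fH// gmulfM multiplicativeV yE mulgV; exact: subgroup1.
Qed.

Lemma extend0Ml (h g : G2) : H2 h -> extend0 f (h * g)%g = extend0 f g.
Proof.
move=> Hh; have [h' _ h'E] := H2phi _ Hh.
have [[x _ <-]|ng] := pselect (range phi g).
  by rewrite -h'E -gmulfM !extend0E fH// h'E.
rewrite !extend0_out// => -[x _ xE]; apply: ng.
by exists (h'^-1 * x)%g => //; rewrite gmulfM multiplicativeV xE h'E mulKg.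
Qed.

Lemma extend0Mr (k g : G2) :
  (forall k' g', H2 (phi k') -> f (g' * k')%g = f g') ->
  H2 k -> extend0 f (g * k)%g = extend0 f g.
Proof.
move=> fHr Hk; have [k' _ k'E] := H2phi _ Hk.
have [[x _ <-]|ng] := pselect (range phi g).
  by rewrite -k'E -gmulfM !extend0E fHr// k'E.
rewrite !extend0_out// => -[x _ xE]; apply: ng.
by exists (x * k'^-1)%g => //; rewrite gmulfM multiplicativeV xE k'E mulgK.
Qed.

End Invariant.
End ExtensionByZero.
Arguments extend0 {G1 G2} phi {V} f y.

(** * Norms, regular representations and rapid decay under extension by zero *)

Section PreimageNorms.
Context {R : realType} {G1 G2 : groupType} {phi : {multiplicative G1 -> G2}}.
Context {H2 : set G2} (sH2 : is_subgroup H2) (H2phi : H2 `<=` range phi).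
Let H1 : set G1 := phi @^-1` H2.

Lemma length_function_on_preimage (L : G2 -> R) :
  length_function_on H2 L -> length_function_on H1 (L \o phi).
Proof.
move=> [[L0 L1 LV LM] LH]; split; last by move=> x; exact: LH.
split=> [g||g|g h] /=; first exact: L0.
- by rewrite multiplicative1.
- by rewrite multiplicativeV.
- by rewrite gmulfM.
Qed.

(** Subadditivity is used twice, for [h * g] and for [g = h^-1 * (h * g)], with [h] and [h^-1] of
    length 0. *)
Lemma length_functionMl (L : G2 -> R) (h g : G2) :
  length_function_on H2 L -> H2 h -> L (h * g)%g = L g.
Proof.
move=> [[_ _ LV LM] LH] /LH Lh; apply/eqP; rewrite eq_le; apply/andP; split.
  by rewrite -[leRHS]add0r -Lh.
by rewrite -{1}[g](mulKg h) -[leRHS]add0r -{1}Lh -(LV h).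
Qed.

Lemma hecke_algebra_mull (f : G1 -> R[i]) (h g : G1) :
  hecke_algebra H1 f -> H2 (phi h) -> f (h * g)%g = f g.
Proof.
move=> [fH _] Hh; rewrite -[(h * g)%g]mulg1 fH//.
exact: subgroup1 (is_subgroup_preimage sH2).
Qed.

Lemma hecke_algebra_mulr (f : G1 -> R[i]) (k g : G1) :
  hecke_algebra H1 f -> H2 (phi k) -> f (g * k)%g = f g.
Proof.
move=> [fH _] Hk; rewrite -[g in LHS]mul1g fH//.
exact: subgroup1 (is_subgroup_preimage sH2).
Qed.

Lemma hecke_algebra_extend0 (f : G1 -> R[i]) :
  hecke_algebra H1 f -> hecke_algebra H2 (extend0 phi f).
Proof.
move=> fhecke; have fl h g := hecke_algebra_mull f h g fhecke.
have fr k g := hecke_algebra_mulr f k g fhecke.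
split=> [h k g Hh Hk|].
  by rewrite (extend0Mr _ sH2 H2phi fl)// (extend0Ml _ sH2 H2phi fl).
have [_ fin] := fhecke.
apply: sub_finite_set (finite_image (image^~ phi) fin).
move=> _ [y fy <-].
(* A point of the support of the extension lies in the image, so its double coset is the image of
   one meeting the support of [f]. *)
have [[x _ xE]|ny] := pselect (range phi y); last first.
  by move: fy; rewrite /= extend0_out// eqxx.
exists (double_coset H1 x).
  by exists x => //=; rewrite -(extend0E f sH2 fl) xE.
by rewrite double_coset_image ?xE.
Qed.

Lemma l2_norm_extend0 (xi : G1 -> R[i]) :
  (forall h g, H1 h -> xi (h * g)%g = xi g) ->
  l2_norm H2 (extend0 phi xi) = l2_norm H1 xi.
Proof.
move=> xiH; rewrite /l2_norm; congr sqrte.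
rewrite (esum_right_cosets_image sH2 H2phi _
  (fun y => (normc (extend0 phi xi y) ^+ 2)%:E)).
- by apply: eq_esum => A _; rewrite (extend0E xi sH2 xiH).
- by move=> h g Hh; rewrite (extend0Ml _ sH2 H2phi xiH).
- by move=> g ng; rewrite extend0_out// normc0 expr0n.
Qed.

Lemma l2_extend0 (xi : G1 -> R[i]) : l2 H1 xi -> l2 H2 (extend0 phi xi).
Proof.
move=> [xiH xifin]; split; last by rewrite l2_norm_extend0.
by move=> h g; exact: (extend0Ml _ sH2 H2phi xiH).
Qed.

Lemma sobolev_norm_extend0 (s : R) (L : G2 -> R) (f : G1 -> R[i]) :
  length_function_on H2 L -> (forall h g, H1 h -> f (h * g)%g = f g) ->
  sobolev_norm H2 s L (extend0 phi f) = sobolev_norm H1 s (L \o phi) f.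
Proof.
move=> lL fH; rewrite /sobolev_norm; congr sqrte.
rewrite (esum_right_cosets_image sH2 H2phi _
  (fun y => (normc (extend0 phi f y) ^+ 2 * (1 + L y) `^ (2 * s))%:E)).
- by apply: eq_esum => A _; rewrite (extend0E f sH2 fH).
- move=> h g Hh; rewrite (extend0Ml _ sH2 H2phi fH)//.
  by rewrite (length_functionMl _ _ _ lL Hh).
- by move=> g ng; rewrite extend0_out// normc0 expr0n mul0r.
Qed.

Lemma regular_repMl (f xi : G1 -> R[i]) (h g : G1) :
  hecke_algebra H1 f -> H1 h ->
  regular_rep H1 f xi (h * g)%g = regular_rep H1 f xi g.
Proof.
move=> fhecke Hh; apply: eq_fsbigr => A _.
by rewrite -mulgA (hecke_algebra_mull _ _ _ fhecke Hh).
Qed.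

Lemma regular_rep_extend0 (f xi : G1 -> R[i]) :
  hecke_algebra H1 f -> (forall h g, H1 h -> xi (h * g)%g = xi g) ->
  regular_rep H2 (extend0 phi f) (extend0 phi xi) =
  extend0 phi (regular_rep H1 f xi).
Proof.
move=> fhecke xiH.
have fl h g := hecke_algebra_mull f h g fhecke.
have fr k g := hecke_algebra_mulr f k g fhecke.
apply/funext => y; have [[x _ <-]|ny] := pselect (range phi y).
  rewrite (extend0E _ sH2); last first.
    by move=> h g; exact: (regular_repMl _ _ _ _ fhecke).
  rewrite /regular_rep (fsbig_right_cosets_image sH2 H2phi _
    (fun z => extend0 phi f (phi x * z^-1)%g * extend0 phi xi z)%R).
  - apply: eq_fsbigr => A _.
    rewrite -multiplicativeV -gmulfM.
    by rewrite (extend0E f sH2 fl) (extend0E xi sH2 xiH).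
  (* Replacing [z] by [h * z] puts [h^-1] at the right end of the argument of the extended [f],
     where right invariance absorbs it. *)
  - move=> h z Hh; rewrite (extend0Ml _ sH2 H2phi xiH)// invgM mulgA.
    by rewrite (extend0Mr _ sH2 H2phi fl _ _ fr (subgroupV sH2 Hh)).
  - by move=> z nz; rewrite (extend0_out xi)// mulr0.
(* Off the image every term vanishes: if both [r] and [y * r^-1] were in the image, so would be
   their product [y]. *)
rewrite extend0_out//; apply: fsbig1 => A _.
set r := coset_repr A; have [[z _ zE]|nr] := pselect (range phi r).
  rewrite (extend0_out f) ?mul0r// => -[w _ wE]; apply: ny.
  by exists (w * z)%g => //; rewrite gmulfM wE zE mulgVK.
by rewrite (extend0_out xi)// mulr0.
Qed.

(** Each [xi] in the unit ball over [G1] extends to one over [G2], and the intertwining relation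
    gives both the same output norm; the second supremum thus runs over at least the values of the
    first. *)
Lemma op_norm_extend0 (f : G1 -> R[i]) : hecke_algebra H1 f ->
  (op_norm H1 (regular_rep H1 f) <=
   op_norm H2 (regular_rep H2 (extend0 phi f)))%E.
Proof.
move=> fhecke; apply: ge_ereal_sup => _ [xi [l2xi xi1] <-].
have [xiH _] := l2xi.
apply: ereal_sup_ubound; exists (extend0 phi xi).
  by split; [exact: l2_extend0|rewrite l2_norm_extend0].
rewrite regular_rep_extend0// l2_norm_extend0// => h g.
exact: (regular_repMl _ _ _ _ fhecke).
Qed.

Lemma property_RD_preimage (L : G2 -> R) :
  length_function_on H2 L -> property_RD H2 L -> property_RD H1 (L \o phi).
Proof.
move=> lL [C [s [C0 s0 RD]]]; exists C, s; split=> // f fhecke.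
apply: le_trans (op_norm_extend0 _ fhecke) _.
rewrite -sobolev_norm_extend0//; last first.
  by move=> h g; exact: hecke_algebra_mull.
exact/RD/hecke_algebra_extend0.
Qed.

End PreimageNorms.

Theorem proposition2p11 (R : realType) (G1 G2 : groupType)
    (phi : {multiplicative G1 -> G2}) (H2 : set G2) :
  finite_set (phi @^-1` [set 1%g]) ->
  H2 `<=` range phi ->
  almost_normal H2 ->
  hecke_pair_RD R H2 ->
  hecke_pair_RD R (phi @^-1` H2).
Proof.
move=> _ H2phi anH2 [_ [L lL RD]].
have sH2 : is_subgroup H2 by case: anH2.
split; first exact: almost_normal_preimage.
exists (L \o phi); first exact: length_function_on_preimage.
exact: property_RD_preimage.
Qed.
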